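(* Let $\boldsymbol d$ be a Wadge degree with $\boldsymbol d\subseteq\boldsymbol{\Pi}^0_3$ and $\boldsymbol d\neq\{\emptyset\},\{2^\omega\}$. Then $\mathscr W_{\boldsymbol d}=\{[A]\in\mathrm{MALG}:\Phi(A)\in\boldsymbol d\}$ is topologically dense in $\mathrm{MALG}$: for every measurable $A$ and every $\varepsilon>0$ there is a measurable $B$ with $\mu(A\triangle B)<\varepsilon$ and $\Phi(B)\in\boldsymbol d$. Moreover $B$ can be chosen so that $\Phi(B)=\Phi(U)=\Phi(C)$ for some open $U$ and some closed $C$.
   Context: $2^\omega$ is the Cantor space; $N_s=\{x:s\subset x\}$; $\mu$ the coin-tossing measure, $\mu(N_s)=2^{-\mathrm{lh}(s)}$. $\Phi(A)=\{x:\lim_n\mu(A\cap N_{x\restriction n})/\mu(N_{x\restriction n})=1\}$ for measurable $A$. $\mathrm{MALG}$ is the measure algebra (measurable sets modulo null sets) with metric $\delta([A],[B])=\mu(A\triangle B)$. For $X,Y\subseteq2^\omega$, $X\le_W Y$ iff $X=f^{-1}(Y)$ for some continuous $f:2^\omega\to2^\omega$; $X\equiv_W Y$ iff both $X\le_W Y$ and $Y\le_W X$; a Wadge degree is an $\equiv_W$-equivalence class. $\boldsymbol{\Pi}^0_3$ is the class of $F_{\sigma\delta}$ sets. *)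

(* Defs.v *)
From Stdlib Require Import Reals Lra Lia List.
Import ListNotations.
Open Scope R_scope.

Definition cantor := nat -> bool.
Definition cset := cantor -> Prop.

Definition restr (x : cantor) (n : nat) : list bool := map x (seq 0 n).

Definition N (s : list bool) : cset := fun x => restr x (length s) = s.

Definition inter (A B : cset) : cset := fun x => A x /\ B x.
Definition diff (A B : cset) : cset := fun x => A x /\ ~ B x.
Definition symdiff (A B : cset) : cset := fun x => (A x /\ ~ B x) \/ (B x /\ ~ A x).
Definition compl (A : cset) : cset := fun x => ~ A x.

(* countable covers by basic sets; None = empty piece *)
Definition weight (o : option (list bool)) : R :=
  match o with None => 0 | Some s => (/2) ^ length s end.

Definition covers (A : cset) (c : nat -> option (list bool)) : Prop :=
  forall x, A x -> exists i s, c i = Some s /\ N s x.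

Definition negsums (A : cset) (r : R) : Prop :=
  exists c l, covers A c /\ infinite_sum (fun i => weight (c i)) l /\ r = - l.

Lemma weight_nonneg o : 0 <= weight o.
Proof.
  destruct o as [s|]; simpl; [apply pow_le; lra | lra].
Qed.

Lemma infinite_sum_nonneg f l :
  (forall i, 0 <= f i) -> infinite_sum f l -> 0 <= l.
Proof.
  intros Hf Hl. destruct (Rle_lt_dec 0 l) as [H|H]; auto.
  destruct (Hl (- l)) as [n Hn]; [lra|].
  specialize (Hn n (Nat.le_refl n)).
  pose proof (cond_pos_sum f n Hf).
  unfold Rdist in Hn. rewrite Rabs_right in Hn by lra. lra.
Qed.

Lemma negsums_bound A : bound (negsums A).
Proof.
  exists 0. intros r [c [l [_ [Hs ->]]]].
  pose proof (infinite_sum_nonneg _ _ (fun i => weight_nonneg (c i)) Hs). lra.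
Qed.

Definition cover_all (i : nat) : option (list bool) :=
  match i with O => Some [] | _ => None end.

Lemma negsums_nonempty A : exists r, negsums A r.
Proof.
  exists (-1). exists cover_all, 1. split; [|split; [|reflexivity]].
  - intros x _. exists O, []. split; reflexivity.
  - intros eps Heps. exists O. intros n _.
    assert (sum_f_R0 (fun i => weight (cover_all i)) n = 1) as ->.
    { induction n as [|n IH]; simpl; [lra|]. rewrite IH. simpl. lra. }
    unfold Rdist. rewrite Rminus_diag, Rabs_R0. exact Heps.
Qed.

(* coin-tossing outer measure: mu*(A) = inf of sums of 2^{-lh s_i}
   over countable covers of A by basic sets N_{s_i} *)
Definition mu (A : cset) : R :=
  - proj1_sig (completeness (negsums A) (negsums_bound A) (negsums_nonempty A)).

(* Caratheodory measurability; on measurable sets mu is the coin-tossing measure *)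
Definition measurable (A : cset) : Prop :=
  forall E : cset, mu E = mu (inter E A) + mu (diff E A).

Definition Phi (A : cset) : cset := fun x =>
  Un_cv (fun n => mu (inter A (N (restr x n))) / mu (N (restr x n))) 1.

Definition agree (x y : cantor) (n : nat) : Prop := forall i, (i < n)%nat -> x i = y i.
Definition open (U : cset) : Prop :=
  forall x, U x -> exists n, forall y, agree x y n -> U y.
Definition closed (C : cset) : Prop := open (compl C).
Definition continuous (f : cantor -> cantor) : Prop :=
  forall x n, exists m, forall y, agree x y m -> agree (f x) (f y) n.

Definition wadge_le (X Y : cset) : Prop :=
  exists f, continuous f /\ forall x, X x <-> Y (f x).
Definition wadge_equiv (X Y : cset) : Prop := wadge_le X Y /\ wadge_le Y X.
Definition wadge_degree (d : cset -> Prop) : Prop :=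
  exists Y, forall X, d X <-> wadge_equiv X Y.

Definition Pi03 (X : cset) : Prop :=
  exists F : nat -> nat -> cset, (forall n m, closed (F n m)) /\
    forall x, X x <-> (forall n, exists m, F n m x).

(* Main.v *)
(** A set [Y] in [Pi03], neither empty nor full, carries a rank: [Y x] holds iff
    [psi x n] tends to infinity, where [psi x n] depends only on the first [n] digits of [x].
    Code [x] by the point of a null closed set (the core) that has the digits of [x] at the squares
    and 0 in the gaps between them.  Every point off the core has a first 1 in a gap, its exit, and
    the points with a given exit are put inside the open set [U] except for a fraction
    [2 ^ - psi x q], which goes to the open complement of [U] and the core; all go to one side as
    soon as the digits of [x] read so far decide membership in [Y].  The gaps grow, and the level
    [q] lags one digit behind, so that near a point of the core the density of [U] is governed by
    the rank of the coded point alone and not by its siblings: the density tends to 1 iff the rank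
    tends to infinity.  Hence [Phi U] is [U] together with the codes of the points of [Y].  It is
    Wadge reducible to [Y] by decoding on the core and by moving a point that exits to one on the
    right side of [Y] with the same digits so far.  Points exiting very early are instead sorted by
    a clopen approximation of [A], which makes [U] close to [A]. *)

From Stdlib Require Import Reals Lra Lia List Classical ClassicalEpsilon.
From Stdlib Require Import FunctionalExtensionality PropExtensionality.
Require Import Defs.
Import ListNotations.
Open Scope R_scope.

Lemma restr_S (x : cantor) (n : nat) : restr x (S n) = restr x n ++ [x n].
Proof. unfold restr. now rewrite seq_S, map_app. Qed.

Lemma restr_length (x : cantor) (n : nat) : length (restr x n) = n.
Proof. unfold restr. now rewrite length_map, length_seq. Qed.

Lemma restr_eq_agree (x y : cantor) (n : nat) : restr x n = restr y n <-> agree x y n.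
Proof.
  induction n as [|n IH].
  - split; [intros _ i Hi; lia | reflexivity].
  - rewrite !restr_S. split.
    + intros H. apply app_inj_tail in H as [H1 H2]. apply IH in H1.
      intros i Hi. destruct (Nat.eq_dec i n) as [->|]; [exact H2 | apply H1; lia].
    + intros H. f_equal; [apply IH; intros i Hi; apply H; lia | f_equal; apply H; lia].
Qed.

Lemma N_restr (x y : cantor) (n : nat) : N (restr x n) y <-> agree x y n.
Proof.
  unfold N. rewrite restr_length, restr_eq_agree.
  split; intros H i Hi; symmetry; auto.
Qed.

Lemma N_snoc (s : list bool) (b : bool) (x : cantor) :
  N (s ++ [b]) x <-> N s x /\ x (length s) = b.
Proof.
  unfold N. rewrite length_app. simpl. rewrite Nat.add_1_r, restr_S. split.
  - intros H. now apply app_inj_tail in H.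
  - now intros [-> ->].
Qed.

Lemma N_cons (a : bool) (s : list bool) (x : cantor) :
  N (a :: s) x <-> x O = a /\ N s (fun i => x (S i)).
Proof.
  unfold N, restr. simpl. rewrite <- seq_shift, map_map. split.
  - intros [= <- H]. auto.
  - now intros [-> ->].
Qed.

Lemma N_nil (x : cantor) : N [] x.
Proof. reflexivity. Qed.

Lemma N_agree (s : list bool) (x y : cantor) : N s x -> agree x y (length s) -> N s y.
Proof.
  unfold N. intros <- H. rewrite restr_length in *. symmetry. now apply restr_eq_agree.
Qed.

(** * The outer measure *)

Lemma half_pow_pos (n : nat) : 0 < (/2) ^ n.
Proof. apply pow_lt. lra. Qed.

Lemma half_pow_small (e : R) : 0 < e -> exists n, (/2) ^ n < e.
Proof.
  intros He. destruct (pow_lt_1_zero (/2)) with (y := e) as [n Hn]; auto.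
  - rewrite Rabs_right; lra.
  - exists n. specialize (Hn n (Nat.le_refl n)).
    rewrite Rabs_right in Hn; auto. left. apply half_pow_pos.
Qed.

Lemma half_pow_le (m n : nat) : (m <= n)%nat -> (/2) ^ n <= (/2) ^ m.
Proof.
  induction 1 as [|n _ IH]; [lra|]. simpl. pose proof (half_pow_pos n). lra.
Qed.

Lemma partial_sums_growing (f : nat -> R) :
  (forall i, 0 <= f i) -> Un_growing (fun n => sum_f_R0 f n).
Proof. intros H n. simpl. specialize (H (S n)). lra. Qed.

(** Weights are nonnegative, so bounded partial sums already converge; a cover then bounds [mu]
    without its sum being computed. *)
Lemma mu_le_cover (A : cset) (c : nat -> option (list bool)) (r : R) :
  covers A c -> (forall n, sum_f_R0 (fun i => weight (c i)) n <= r) -> mu A <= r.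
Proof.
  intros Hc Hr.
  destruct (growing_cv (fun n => sum_f_R0 (fun i => weight (c i)) n)) as [l Hl].
  - apply partial_sums_growing. intros i. apply weight_nonneg.
  - exists r. intros y [n ->]. apply Hr.
  - unfold mu. destruct (completeness _ _ _) as [m [Hub Hlub]]. simpl.
    assert (l <= r).
    { eapply Rle_cv_lim with (Vn := fun _ => r); [exact Hr|exact Hl|].
      intros e He. exists O. intros. rewrite Rdist_eq. exact He. }
    assert (- l <= m) by (apply Hub; exists c, l; auto). lra.
Qed.

Lemma mu_approx_cover (A : cset) (e : R) : 0 < e ->
  exists c l, covers A c /\ infinite_sum (fun i => weight (c i)) l /\ l < mu A + e.
Proof.
  intros He. unfold mu. destruct (completeness _ _ _) as [m [Hub Hlub]]. simpl.
  apply NNPP. intros H.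
  assert (m <= m - e); [|lra].
  apply Hlub. intros r [c [l [Hc [Hl ->]]]].
  destruct (Rle_lt_dec (- l) (m - e)); auto.
  exfalso. apply H. exists c, l. repeat split; auto. lra.
Qed.

Lemma partial_sum_le (c : nat -> option (list bool)) (l : R) (n : nat) :
  infinite_sum (fun i => weight (c i)) l -> sum_f_R0 (fun i => weight (c i)) n <= l.
Proof.
  intros H. apply sum_incr; [exact H|]. intros i. apply weight_nonneg.
Qed.

Lemma mu_nonneg (A : cset) : 0 <= mu A.
Proof.
  unfold mu. destruct (completeness _ _ _) as [m [Hub Hlub]]. simpl.
  assert (m <= 0); [|lra].
  apply Hlub. intros r [c [l [_ [Hl ->]]]].
  pose proof (infinite_sum_nonneg _ _ (fun i => weight_nonneg (c i)) Hl). lra.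
Qed.

Lemma mu_mono (A B : cset) : (forall x, A x -> B x) -> mu A <= mu B.
Proof.
  intros H. apply le_epsilon. intros e He.
  destruct (mu_approx_cover B e He) as [c [l [Hc [Hl Hle]]]].
  apply Rle_trans with l; [|lra]. apply mu_le_cover with c.
  - intros x Hx. auto.
  - intros n. now apply partial_sum_le.
Qed.

Lemma mu_ext (A B : cset) : (forall x, A x <-> B x) -> mu A = mu B.
Proof. intros H. apply Rle_antisym; apply mu_mono; intros x; apply H. Qed.

Lemma sum_interleave (f g : nat -> R) (n : nat) :
  sum_f_R0 (fun i => if Nat.even i then f (Nat.div2 i) else g (Nat.div2 i)) (S (2 * n)) =
  sum_f_R0 f n + sum_f_R0 g n.
Proof.
  induction n as [|n IH]; [simpl; lra|].
  replace (2 * S n)%nat with (S (S (2 * n))) by lia.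
  rewrite tech5, tech5, IH, (tech5 f), (tech5 g).
  replace (S (S (2 * n))) with (2 * S n)%nat by lia.
  rewrite Nat.even_even, Nat.div2_double, Nat.div2_succ_double.
  replace (Nat.even (S (2 * S n))) with false; [lra|].
  now rewrite Nat.even_succ, Nat.odd_even.
Qed.

Lemma mu_le_add (C A B : cset) : (forall x, C x -> A x \/ B x) -> mu C <= mu A + mu B.
Proof.
  intros H. apply le_epsilon. intros e He.
  destruct (mu_approx_cover A (e/2)) as [a [la [Ha [Hla Hlea]]]]; [lra|].
  destruct (mu_approx_cover B (e/2)) as [b [lb [Hb [Hlb Hleb]]]]; [lra|].
  apply Rle_trans with (la + lb); [|lra].
  set (c := fun i => if Nat.even i then a (Nat.div2 i) else b (Nat.div2 i)).
  apply mu_le_cover with c.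
  - intros x Hx. destruct (H x Hx) as [Hx'|Hx'].
    + destruct (Ha x Hx') as [i [s [Hi Hs]]]. exists (2 * i)%nat, s. split; auto.
      unfold c. now rewrite Nat.even_even, Nat.div2_double.
    + destruct (Hb x Hx') as [i [s [Hi Hs]]]. exists (S (2 * i)), s. split; auto.
      unfold c. now rewrite Nat.even_succ, Nat.odd_even, Nat.div2_succ_double.
  - intros n.
    apply Rle_trans with (sum_f_R0 (fun i => weight (c i)) (S (2 * n))).
    + apply Rge_le, growing_prop; [|lia].
      apply partial_sums_growing. intros i. apply weight_nonneg.
    + erewrite sum_eq; [rewrite (sum_interleave (fun i => weight (a i)) (fun i => weight (b i)))|].
      * pose proof (partial_sum_le a la n Hla). pose proof (partial_sum_le b lb n Hlb). lra.
      * intros i _. unfold c. now destruct (Nat.even i).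
Qed.

Lemma mu_N_le (s : list bool) : mu (N s) <= (/2) ^ length s.
Proof.
  apply mu_le_cover with (fun i => match i with O => Some s | _ => None end).
  - intros x Hx. exists O, s. auto.
  - intros n. induction n as [|n IH]; simpl in *; lra.
Qed.

(* [meet t s] denotes the cylinder [N t] intersected with [N s], or [None] if that is empty. *)
Fixpoint meet (t s : list bool) : option (list bool) :=
  match t, s with
  | [], _ => Some s
  | _, [] => Some t
  | a :: t', b :: s' =>
      if Bool.eqb a b then option_map (cons a) (meet t' s') else None
  end.

Definition omeet (t : list bool) (o : option (list bool)) : option (list bool) :=
  match o with None => None | Some s => meet t s end.

Lemma weight_cons (a : bool) (o : option (list bool)) :
  weight (option_map (cons a) o) = weight o / 2.
Proof. destruct o; simpl; lra. Qed.

Lemma meet_N (t s : list bool) (x : cantor) :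
  N t x -> N s x -> exists r, meet t s = Some r /\ N r x.
Proof.
  revert s x. induction t as [|a t IH]; intros s x Ht Hs; [now exists s|].
  destruct s as [|b s]; [now exists (a :: t)|].
  apply N_cons in Ht as [Ha Ht]. apply N_cons in Hs as [Hb Hs].
  destruct (IH _ _ Ht Hs) as [r [Hr Hx]]. simpl.
  assert (a = b) as <- by congruence.
  rewrite Bool.eqb_reflx, Hr. exists (a :: r). split; auto. now apply N_cons.
Qed.

Lemma meet_diag (s : list bool) : meet s s = Some s.
Proof. induction s as [|a s IH]; simpl; [|rewrite Bool.eqb_reflx, IH]; reflexivity. Qed.

(** The weight of a cover, localised to a cylinder, is additive under halving the cylinder.
    [mu_split] and the descent in [mu_full] both rest on this. *)
Lemma omeet_split (t : list bool) (o : option (list bool)) :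
  weight (omeet t o) = weight (omeet (t ++ [true]) o) + weight (omeet (t ++ [false]) o).
Proof.
  destruct o as [s|]; [|simpl; lra]. simpl. revert s.
  induction t as [|a t IH]; intros s.
  - destruct s as [|[] s]; simpl; lra.
  - destruct s as [|b s].
    + simpl. rewrite !length_app. simpl. rewrite !pow_add. lra.
    + simpl. destruct (Bool.eqb a b); [|simpl; lra].
      rewrite !weight_cons, IH. lra.
Qed.

Lemma omeet_nil (o : option (list bool)) : omeet [] o = o.
Proof. now destruct o. Qed.

Lemma omeet_weight_le (t : list bool) (o : option (list bool)) :
  weight (omeet t o) <= weight o.
Proof.
  destruct o as [s|]; [|simpl; lra]. simpl omeet. revert s.
  induction t as [|a t IH]; intros s; [apply Rle_refl|].
  destruct s as [|b s].
  - apply (half_pow_le 0). apply Nat.le_0_l.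
  - simpl meet. destruct (Bool.eqb a b); [|apply weight_nonneg].
    rewrite weight_cons. specialize (IH s). simpl in *. lra.
Qed.

Lemma sum_omeet_split (t : list bool) (c : nat -> option (list bool)) (n : nat) :
  sum_f_R0 (fun i => weight (omeet t (c i))) n =
  sum_f_R0 (fun i => weight (omeet (t ++ [true]) (c i))) n +
  sum_f_R0 (fun i => weight (omeet (t ++ [false]) (c i))) n.
Proof. rewrite <- sum_plus. apply sum_eq. intros i _. apply omeet_split. Qed.

Lemma sum_omeet_growing (t : list bool) (c : nat -> option (list bool)) :
  Un_growing (fun n => sum_f_R0 (fun i => weight (omeet t (c i))) n).
Proof. apply partial_sums_growing. intros i. apply weight_nonneg. Qed.

(** For the lower bound, one nearly optimal cover is cut along the two halves; the pieces cover the
    two parts and weigh no more in total than the cover. *)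
Lemma mu_split (E : cset) (s : list bool) :
  mu (inter E (N s)) =
  mu (inter E (N (s ++ [true]))) + mu (inter E (N (s ++ [false]))).
Proof.
  apply Rle_antisym.
  - apply mu_le_add. intros x [Hx Hs]. unfold inter. rewrite !N_snoc.
    destruct (x (length s)); auto.
  - apply le_epsilon. intros e He.
    destruct (mu_approx_cover (inter E (N s)) e He) as [c [l [Hc [Hl Hle]]]].
    set (S_ t := sum_f_R0 (fun i => weight (omeet t (c i)))).
    assert (Hb : forall t n, S_ t n <= l).
    { intros t n. apply Rle_trans with (sum_f_R0 (fun i => weight (c i)) n).
      - apply sum_Rle. intros i _. apply omeet_weight_le.
      - now apply partial_sum_le. }
    assert (Hlim : forall t, exists r, Un_cv (S_ t) r).
    { intros t. destruct (growing_cv (S_ t)) as [r Hr].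
      - apply sum_omeet_growing.
      - exists l. intros y [n ->]. apply Hb.
      - now exists r. }
    assert (Hcov : forall b r, Un_cv (S_ (s ++ [b])) r -> mu (inter E (N (s ++ [b]))) <= r).
    { intros b r Hr. apply mu_le_cover with (fun i => omeet (s ++ [b]) (c i)).
      - intros x [Hx Hs]. destruct (Hc x) as [i [u [Hi Hu]]].
        { split; auto. now apply N_snoc in Hs. }
        destruct (meet_N _ _ _ Hs Hu) as [v [Hv Hx']]. exists i, v. rewrite Hi. auto.
      - intros n. apply (growing_ineq (S_ (s ++ [b]))); auto. apply sum_omeet_growing. }
    destruct (Hlim (s ++ [true])) as [r1 H1]. destruct (Hlim (s ++ [false])) as [r2 H2].
    pose proof (Hcov _ _ H1). pose proof (Hcov _ _ H2).
    assert (r1 + r2 <= l); [|lra].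
    eapply Rle_cv_lim with (Vn := fun _ => l); [|apply CV_plus; [exact H1|exact H2]|].
    + intros n. simpl. unfold S_. rewrite <- sum_omeet_split. apply Hb.
    + intros e' He'. exists O. intros. rewrite Rdist_eq. exact He'.
Qed.

(* If a cover had total weight below 1, one could descend along cylinders on which the cover
   is too light, and the branch so obtained would be a point missed by the cover. *)
Lemma mu_full : 1 <= mu (N []).
Proof.
  apply Rnot_lt_le. intros Hlt.
  destruct (mu_approx_cover (N []) (1 - mu (N []))) as [c [l [Hc [Hl Hle]]]]; [lra|].
  set (light t := exists r, r < (/2) ^ length t /\
         forall n, sum_f_R0 (fun i => weight (omeet t (c i))) n <= r).
  assert (H0 : light []).
  { exists l. split; [simpl; lra|]. intros n. rewrite (sum_eq _ (fun i => weight (c i))).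
    - now apply partial_sum_le.
    - intros i _. now rewrite omeet_nil. }
  assert (Hstep : forall t, light t -> exists b, light (t ++ [b])).
  { intros t [r [Hr Hn]]. apply NNPP. intros H.
    (* The midpoint of [r / 2] and half the measure of the cylinder: small enough to witness
       lightness of a half, yet two halves that both exceed it would exceed [r]. *)
    set (r' := (r / 2 + (/2) ^ length t / 2) / 2).
    assert (Hbig : forall b, exists n,
               r' < sum_f_R0 (fun i => weight (omeet (t ++ [b]) (c i))) n).
    { intros b. apply NNPP. intros Hno. apply H. exists b, r'. split.
      - rewrite length_app, pow_add. unfold r'. simpl. lra.
      - intros n. apply Rnot_lt_le. intros Hlt'. apply Hno. now exists n. }
    destruct (Hbig true) as [n1 H1]. destruct (Hbig false) as [n2 H2].
    specialize (Hn (n1 + n2)%nat). rewrite sum_omeet_split in Hn.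
    pose proof (growing_prop _ (n1 + n2) n1 (sum_omeet_growing (t ++ [true]) c)) as G1.
    pose proof (growing_prop _ (n1 + n2) n2 (sum_omeet_growing (t ++ [false]) c)) as G2.
    specialize (G1 ltac:(lia)). specialize (G2 ltac:(lia)). simpl in G1, G2.
    unfold r' in *. lra. }
  set (pick t := epsilon (inhabits true) (fun b => light (t ++ [b]))).
  set (br := fix br n := match n with O => [] | S n => br n ++ [pick (br n)] end).
  assert (Hbr : forall n, light (br n)).
  { induction n as [|n IH]; [exact H0|]. simpl. unfold pick. now apply epsilon_spec, Hstep. }
  set (z := fun n => pick (br n)).
  assert (Hz : forall n, restr z n = br n).
  { induction n as [|n IH]; [reflexivity|]. rewrite restr_S, IH. reflexivity. }
  destruct (Hc z (N_nil z)) as [i [s [Hi Hs]]].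
  destruct (Hbr (length s)) as [r [Hr Hn]].
  rewrite <- Hz, Hs in Hr, Hn. specialize (Hn i).
  (* The piece covering [z] is a cylinder on the branch itself, so it alone gives that cylinder its
     full weight. *)
  assert ((/2) ^ length s <= sum_f_R0 (fun i => weight (omeet s (c i))) i); [|lra].
  assert (Hw : weight (omeet s (c i)) = (/2) ^ length s) by (rewrite Hi; simpl; now rewrite meet_diag).
  rewrite <- Hw. destruct i as [|i]; [apply Rle_refl|]. rewrite tech5.
  pose proof (cond_pos_sum (fun i => weight (omeet s (c i))) i (fun i => weight_nonneg _)). lra.
Qed.

Lemma mu_N (s : list bool) : mu (N s) = (/2) ^ length s.
Proof.
  induction s as [|b s IH] using rev_ind.
  - apply Rle_antisym; [apply mu_N_le | apply mu_full].
  - pose proof (mu_split (N s) s) as H.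
    rewrite (mu_ext (inter (N s) (N s)) (N s)), IH in H by (unfold inter; tauto).
    rewrite !(mu_ext (inter (N s) (N (s ++ [_]))) (N (s ++ [_]))) in H
      by (intros x; unfold inter; rewrite N_snoc; tauto).
    pose proof (mu_N_le (s ++ [true])) as Ht. pose proof (mu_N_le (s ++ [false])) as Hf.
    rewrite length_app, pow_add in *. simpl in *.
    destruct b; lra.
Qed.

Lemma mu_empty (A : cset) : (forall x, ~ A x) -> mu A = 0.
Proof.
  intros H. apply Rle_antisym; [|apply mu_nonneg].
  apply mu_le_cover with (fun _ => None).
  - intros x Hx. now apply H in Hx.
  - intros n. induction n as [|n IH]; simpl in *; lra.
Qed.

Lemma mu_inter_nil (E : cset) : mu (inter E (N [])) = mu E.
Proof. apply mu_ext. intros x. unfold inter. pose proof (N_nil x). tauto. Qed.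

(** * Measurability *)

Definition determined (n : nat) (D : cset) : Prop :=
  forall x y, agree x y n -> D x -> D y.

Lemma agree_sym (x y : cantor) (n : nat) : agree x y n -> agree y x n.
Proof. intros H i Hi. symmetry. auto. Qed.

Lemma agree_le (x y : cantor) (m n : nat) : (m <= n)%nat -> agree x y n -> agree x y m.
Proof. intros H Ha i Hi. apply Ha. lia. Qed.

Lemma agree_trans (x y z : cantor) (n : nat) : agree x y n -> agree y z n -> agree x z n.
Proof. intros H1 H2 i Hi. now rewrite H1, H2. Qed.

(** A cylinder of length [n] lies inside [D] or misses it, so the splitting is trivial there;
    halving carries it up to the whole space. *)
Lemma determined_measurable (n : nat) (D : cset) : determined n D -> measurable D.
Proof.
  intros HD E.
  assert (H : forall k s, (length s + k = n)%nat ->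
    mu (inter E (N s)) = mu (inter (inter E D) (N s)) + mu (inter (diff E D) (N s))).
  { induction k as [|k IH]; intros s Hs.
    - assert (Hc : (forall x, N s x -> D x) \/ (forall x, N s x -> ~ D x)).
      { destruct (classic (exists x, N s x /\ D x)) as [[x [Hx Hd]]|Hno].
        - left. intros y Hy. apply HD with x; auto.
          replace n with (length s) by lia. apply restr_eq_agree. congruence.
        - right. intros x Hx Hd. apply Hno. eauto. }
      destruct Hc as [Hc|Hc].
      + rewrite (mu_empty (inter (diff E D) _)), Rplus_0_r.
        * apply mu_ext. intros x. specialize (Hc x). unfold inter. tauto.
        * intros x. specialize (Hc x). unfold inter, diff. tauto.
      + rewrite (mu_empty (inter (inter E D) _)), Rplus_0_l.
        * apply mu_ext. intros x. specialize (Hc x). unfold inter, diff. tauto.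
        * intros x. specialize (Hc x). unfold inter. tauto.
    - rewrite (mu_split E), (mu_split (inter E D)), (mu_split (diff E D)).
      rewrite (IH (s ++ [true])), (IH (s ++ [false])) by (rewrite length_app; simpl; lia).
      lra. }
  specialize (H n [] eq_refl). now rewrite !mu_inter_nil in H.
Qed.

(** Replacing [A] by [D] changes each part of the Caratheodory equation by at most the measure of
    the symmetric difference. *)
Lemma measurable_of_approx (A : cset) :
  (forall e, 0 < e -> exists n D, determined n D /\ mu (symdiff A D) < e) -> measurable A.
Proof.
  intros H E. apply Rle_antisym.
  - apply mu_le_add. intros x Hx. unfold inter, diff. tauto.
  - apply le_epsilon. intros e He. destruct (H (e/2)) as [n [D [HD Hd]]]; [lra|].
    rewrite (determined_measurable n D HD E).
    assert (mu (inter E A) <= mu (inter E D) + mu (symdiff A D)).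
    { apply mu_le_add. intros x. unfold inter, symdiff. tauto. }
    assert (mu (diff E A) <= mu (diff E D) + mu (symdiff A D)).
    { apply mu_le_add. intros x. unfold diff, symdiff. tauto. }
    lra.
Qed.

Lemma measurable_approx (A : cset) (e : R) : measurable A -> 0 < e ->
  exists n D, determined n D /\ mu (symdiff A D) < e.
Proof.
  intros HA He.
  destruct (mu_approx_cover A (e/2)) as [c [l [Hc [Hl Hle]]]]; [lra|].
  set (O_ := fun x => exists i s, c i = Some s /\ N s x).
  assert (HO : mu O_ <= l).
  { apply mu_le_cover with c; [easy|]. intros n. now apply partial_sum_le. }
  (* With the open cover as test set, measurability bounds [diff O_ A] by [l - mu A], hence by
     [e / 2]. The finite part [D] of the cover loses less than another [e / 2]. *)
  rewrite (HA O_) in HO.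
  assert (mu A <= mu (inter O_ A)) by (apply mu_mono; split; auto; now apply Hc).
  destruct (Hl (e/2)) as [n Hn]; [lra|]. specialize (Hn n (Nat.le_refl n)).
  unfold Rdist in Hn. apply Rabs_def2 in Hn.
  set (D := fun x => exists i s, (i <= n)%nat /\ c i = Some s /\ N s x).
  set (len i := match c i with Some s => length s | None => O end).
  assert (Hm : exists m, forall i, (i <= n)%nat -> (len i <= m)%nat).
  { clear. induction n as [|n [m Hm]].
    - exists (len O). intros i Hi. now replace i with O by lia.
    - exists (m + len (S n))%nat. intros i Hi. destruct (Nat.eq_dec i (S n)) as [->|]; [lia|].
      specialize (Hm i). lia. }
  destruct Hm as [m Hm]. exists m, D. split.
  - intros x y Hxy [i [s [Hi [Hs Hx]]]]. exists i, s. repeat split; auto.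
    apply N_agree with x; auto. apply agree_le with m; auto.
    specialize (Hm i Hi). unfold len in Hm. now rewrite Hs in Hm.
  - assert (mu (diff O_ D) <= l - sum_f_R0 (fun i => weight (c i)) n).
    { apply mu_le_cover with (fun i => c (S n + i)%nat).
      - intros x [[i [s [Hi Hs]]] Hx]. exists (i - S n)%nat, s. split; auto.
        destruct (Nat.le_gt_cases i n) as [Hin|Hin].
        + exfalso. apply Hx. exists i, s. auto.
        + now replace (S n + (i - S n))%nat with i by lia.
      - intros k. pose proof (partial_sum_le c l (S n + k) Hl) as Hk.
        rewrite (tech2 _ n) in Hk by lia.
        replace (S n + k - S n)%nat with k in Hk by lia. lra. }
    assert (mu (symdiff A D) <= mu (diff O_ D) + mu (diff O_ A)); [|lra].
    apply mu_le_add. intros x [[Hx Hd]|[[i [s [Hi [Hs Hx]]]] Hd]].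
    + left. split; auto. now apply Hc.
    + right. split; auto. now exists i, s.
Qed.

(** * Density points *)

Lemma Phi_of_nbhd (A : cset) (z : cantor) (n : nat) :
  (forall y, agree z y n -> A y) -> Phi A z.
Proof.
  intros H e He. exists n. intros k Hk.
  rewrite (mu_ext (inter A (N (restr z k))) (N (restr z k))).
  - rewrite Rdiv_diag; [now rewrite Rdist_eq|].
    rewrite mu_N. pose proof (half_pow_pos (length (restr z k))). lra.
  - intros x. unfold inter. split; [tauto|]. intros Hx. split; auto.
    apply H. apply N_restr in Hx. apply agree_le with k; auto.
Qed.

(** Subadditivity turns a bound on the complement into a lower bound on the density. The factor 2
    leaves room for the two error terms of [Phi_core_of_Y]. *)
Lemma Phi_intro (A : cset) (z : cantor) :
  (forall M, exists k0, forall k, (k0 <= k)%nat ->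
     mu (diff (N (restr z k)) A) <= (/2) ^ k * (2 * (/2) ^ M)) -> Phi A z.
Proof.
  intros H e He. destruct (half_pow_small (e/2)) as [M HM]; [lra|].
  destruct (H M) as [k0 Hk0]. exists k0. intros k Hk. specialize (Hk0 k Hk).
  assert (H1 : mu (N (restr z k)) <= mu (inter A (N (restr z k))) + mu (diff (N (restr z k)) A)).
  { apply mu_le_add. intros x. unfold inter, diff. tauto. }
  assert (H2 : mu (inter A (N (restr z k))) <= mu (N (restr z k))).
  { apply mu_mono. intros x. unfold inter. tauto. }
  rewrite mu_N, restr_length in *. pose proof (half_pow_pos k) as Hp.
  set (p := (/2) ^ k) in *. set (m := mu (inter A _)) in *.
  assert (m / p <= 1) by (apply Rmult_le_reg_r with p; auto; unfold Rdiv; rewrite Rmult_assoc, Rinv_l; lra).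
  assert (1 - e < m / p).
  { apply Rmult_lt_reg_r with p; auto. unfold Rdiv. rewrite Rmult_assoc, Rinv_l by lra.
    pose proof (Rmult_lt_compat_l p _ _ Hp HM). lra. }
  unfold Rdist. apply Rabs_def1; lra.
Qed.

Lemma Phi_elim (A : cset) (z : cantor) (e : R) : Phi A z -> 0 < e ->
  exists k0, forall k, (k0 <= k)%nat -> (1 - e) * (/2) ^ k < mu (inter A (N (restr z k))).
Proof.
  intros H He. destruct (H e He) as [k0 Hk0]. exists k0. intros k Hk.
  specialize (Hk0 k Hk). unfold Rdist in Hk0. apply Rabs_def2 in Hk0.
  rewrite mu_N, restr_length in Hk0. pose proof (half_pow_pos k) as Hp.
  set (p := (/2) ^ k) in *. set (m := mu (inter A _)) in *.
  replace m with (m / p * p) by (field; lra).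
  apply Rmult_lt_compat_r; lra.
Qed.

Lemma Phi_of_disjoint_nbhd (A : cset) (z : cantor) (n : nat) :
  (forall y, agree z y n -> ~ A y) -> ~ Phi A z.
Proof.
  intros H HP. destruct (Phi_elim A z (/2) HP) as [k0 Hk]; [lra|].
  specialize (Hk (k0 + n)%nat). rewrite mu_empty in Hk.
  - pose proof (half_pow_pos (k0 + n)). specialize (Hk ltac:(lia)). lra.
  - intros x [Hx Hs]. apply N_restr in Hs. apply (H x); auto.
    apply agree_le with (k0 + n)%nat; auto. lia.
Qed.

Lemma Phi_null (A B : cset) (z : cantor) :
  (forall x, A x -> B x) -> mu (diff B A) = 0 -> (Phi B z <-> Phi A z).
Proof.
  intros Hs H0.
  assert (H : forall k, mu (inter B (N (restr z k))) = mu (inter A (N (restr z k)))).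
  { intros k. apply Rle_antisym.
    - rewrite <- (Rplus_0_r (mu (inter A _))), <- H0. apply mu_le_add.
      intros x. unfold inter, diff. tauto.
    - apply mu_mono. intros x [Hx Hn]. split; auto. }
  unfold Phi. split; apply Un_cv_ext; intros n; now rewrite H.
Qed.

Definition zeros (z : cantor) (a j : nat) : Prop :=
  forall i, (a <= i < a + j)%nat -> z i = false.

Lemma mu_zeros_at (s : list bool) (j : nat) :
  mu (fun y => N s y /\ zeros y (length s) j) = (/2) ^ (length s + j).
Proof.
  revert s. induction j as [|j IH]; intros s.
  - rewrite Nat.add_0_r, <- mu_N. apply mu_ext. intros y. split; [tauto|].
    intros Hy. split; [exact Hy|]. intros i Hi. lia.
  - replace (length s + S j)%nat with (length (s ++ [false]) + j)%nat
      by (rewrite length_app; simpl; lia).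
    rewrite <- IH. apply mu_ext. intros y. rewrite N_snoc, length_app. simpl. split.
    + intros [Hs Hz]. repeat split; auto.
      * apply Hz. lia.
      * intros i Hi. apply Hz. lia.
    + intros [[Hs H0] Hz]. split; auto. intros i Hi.
      destruct (Nat.eq_dec i (length s)) as [->|]; [exact H0|]. apply Hz. lia.
Qed.

(** The digits between the end of [s] and [a] are free; halving over them reduces to
    [mu_zeros_at]. *)
Lemma mu_zeros (s : list bool) (a j : nat) (A : cset) : (length s <= a)%nat ->
  (forall y, A y -> N s y /\ zeros y a j) -> mu A <= (/2) ^ (length s + j).
Proof.
  remember (a - length s)%nat as d eqn:Hd. revert s A Hd.
  induction d as [|d IH]; intros s A Hd Hle H.
  - rewrite <- mu_zeros_at. apply mu_mono. replace (length s) with a by lia. exact H.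
  - assert (HA : mu A = mu (inter A (N s))).
    { apply mu_ext. intros x. unfold inter. split; [|tauto]. intros Hx. split; auto. now apply H. }
    rewrite HA, mu_split.
    assert (Hb : forall b, mu (inter A (N (s ++ [b]))) <= (/2) ^ (S (length s + j))).
    { intros b. replace (S (length s + j)) with (length (s ++ [b]) + j)%nat
        by (rewrite length_app; simpl; lia).
      apply IH; try (rewrite length_app; simpl; lia).
      intros y [Hy Hs]. split; auto. now apply H. }
    pose proof (Hb true). pose proof (Hb false). simpl in *. lra.
Qed.

(** * A rank for [Pi03] sets *)

(** [r] is the minimum of [n] and the least [k] with [P k]. The cap covers the case that there is no
    such [k], and yields [psi x n <= n]. *)
Lemma bounded_search (P : nat -> Prop) (n : nat) :
  exists r, forall m, (m <= r)%nat <-> (m <= n)%nat /\ forall k, (k < m)%nat -> ~ P k.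
Proof.
  induction n as [|n [r Hr]].
  - exists O. intros m. split; [intros Hm; split; [lia | intros; lia] | lia].
  - destruct (classic (r = n /\ ~ P n)) as [[-> Hn]|Hno].
    + exists (S n). intros m. split; [|lia]. intros Hm. split; auto. intros k Hk.
      destruct (Nat.eq_dec k n) as [->|]; auto.
      apply (proj1 (Hr n) (Nat.le_refl n)). lia.
    + exists r. intros m. rewrite Hr. split; [intros [H1 H2]; split; auto|].
      intros [H1 H2]. split; auto. destruct (Nat.eq_dec m (S n)) as [->|]; [|lia].
      exfalso. apply Hno. split; [|apply H2; lia].
      assert (n <= r)%nat by (apply Hr; split; auto).
      assert (r <= n)%nat by (apply (Hr r); auto). lia.
Qed.

Lemma eventually_all (P : nat -> nat -> Prop) (m : nat) :
  (forall k, (k < m)%nat -> exists n0, forall n, (n0 <= n)%nat -> P k n) ->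
  exists n0, forall n, (n0 <= n)%nat -> forall k, (k < m)%nat -> P k n.
Proof.
  induction m as [|m IH]; intros H; [exists O; intros; lia|].
  destruct IH as [n1 H1]; [intros k Hk; apply H; lia|].
  destruct (H m) as [n2 H2]; [lia|]. exists (n1 + n2)%nat. intros n Hn k Hk.
  destruct (Nat.eq_dec k m) as [->|]; [apply H2; lia|]. apply H1; lia.
Qed.

(* For the k-th F_sigma set, say that stage n knows m if m <= n and the neighbourhood x|n misses
   the first m closed pieces.  New knowledge is acquired infinitely often iff x lies outside the
   F_sigma set; the rank at stage n is the least k acquiring new knowledge at that stage. *)
Lemma Pi03_rank (Y : cset) : Pi03 Y ->
  exists psi : cantor -> nat -> nat,
    (forall x y n, agree x y n -> psi x n = psi y n) /\
    (forall x n, (psi x n <= n)%nat) /\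
    (forall x, Y x <-> forall m, exists n0, forall n, (n0 <= n)%nat -> (m <= psi x n)%nat).
Proof.
  intros [F [Fcl HF]].
  set (knows k x n m := (m <= n)%nat /\
         forall j y, (j < m)%nat -> agree x y n -> ~ F k j y).
  set (change k x n := exists m, knows k x n m /\ ~ knows k x (n - 1)%nat m).
  assert (Hmono : forall k x n n' m, (n <= n')%nat -> knows k x n m -> knows k x n' m).
  { intros k x n n' m Hn [H1 H2]. split; [lia|]. intros j y Hj Hy. apply H2; auto.
    apply agree_le with n'; auto. }
  assert (Hloc : forall k x y n n' m, agree x y n -> (n' <= n)%nat ->
            knows k x n' m -> knows k y n' m).
  { intros k x y n n' m Ha Hn [H1 H2]. split; auto. intros j w Hj Hw. apply H2; auto.
    intros i Hi. rewrite Ha by lia. auto. }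
  assert (Hcloc : forall k x y n, agree x y n -> change k x n -> change k y n).
  { intros k x y n Ha [m [H1 H2]]. exists m. split.
    - apply Hloc with x n; auto.
    - intros H. apply H2. apply Hloc with y n; auto; [now apply agree_sym | lia]. }
  (* If [x] lies in [F k j], only the values [m <= j] can ever be known, and by monotonicity each is
     newly learnt at most once. *)
  assert (Hfin : forall k x, (exists j, F k j x) ->
            exists n0, forall n, (n0 <= n)%nat -> ~ change k x n).
  { intros k x [j Hj].
    destruct (eventually_all (fun m n => ~ (knows k x n m /\ ~ knows k x (n - 1)%nat m)) (S j))
      as [n0 Hn0].
    - intros m Hm. destruct (classic (exists n, knows k x n m)) as [[n1 H1]|Hno].
      + exists (S n1). intros n Hn [_ H]. apply H. apply Hmono with n1; auto. lia.
      + exists O. intros n _ [H _]. apply Hno. now exists n.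
    - exists n0. intros n Hn [m Hm]. apply (Hn0 n Hn m); auto.
      destruct (Nat.lt_ge_cases m (S j)) as [|Hlt]; auto.
      exfalso. destruct Hm as [[_ H] _]. apply (H j x); auto. intros i _. reflexivity. }
  (* Closedness makes [S n0] known at some stage, while the clause [m <= n] forbids it at stage
     [n0]; so it is first learnt after [n0]. *)
  assert (Hinf : forall k x, ~ (exists j, F k j x) ->
            forall n0, exists n, (n0 <= n)%nat /\ change k x n).
  { intros k x Hno n0.
    destruct (eventually_all (fun j n => forall y, agree x y n -> ~ F k j y) (S n0)) as [n1 H1].
    { intros j _. destruct (Fcl k j x) as [n Hn]; [intros H; apply Hno; now exists j|].
      exists n. intros n' Hn' y Hy. apply Hn. apply agree_le with n'; auto. }
    assert (Hk : knows k x (n1 + S n0)%nat (S n0)).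
    { split; [lia|]. intros j y Hj Hy. apply (H1 (n1 + S n0)%nat) with (k := j); auto. lia. }
    assert (Hk0 : ~ knows k x n0 (S n0)) by (intros [H _]; lia).
    revert Hk. generalize (n1 + S n0)%nat as e. induction e as [|e IH]; intros He.
    - exfalso. apply Hk0. apply Hmono with O; auto. lia.
    - destruct (classic (knows k x e (S n0))) as [H|H]; [auto|].
      exists (S e). split.
      + destruct (Nat.le_gt_cases n0 (S e)) as [|Hlt]; auto.
        exfalso. apply Hk0. apply Hmono with (S e); auto. lia.
      + exists (S n0). replace (S e - 1)%nat with e by lia. auto. }
  set (psi x n := proj1_sig (constructive_indefinite_description _
                    (bounded_search (fun k => change k x n) n))).
  assert (Hpsi : forall x n m, (m <= psi x n)%nat <->
            (m <= n)%nat /\ forall k, (k < m)%nat -> ~ change k x n).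
  { intros x n m. unfold psi. now destruct (constructive_indefinite_description _ _) as [r Hr]. }
  assert (Hle : forall x y n, agree x y n -> (psi x n <= psi y n)%nat).
  { intros x y n Ha. apply Hpsi. destruct (proj1 (Hpsi x n _) (Nat.le_refl _)) as [H1 H2].
    split; auto. intros k Hk Hc. apply (H2 k Hk). apply Hcloc with y; auto. now apply agree_sym. }
  exists psi. split; [|split].
  - intros x y n Ha. apply Nat.le_antisymm; apply Hle; auto. now apply agree_sym.
  - intros x n. now apply (Hpsi x n (psi x n)).
  - intros x. rewrite HF. split.
    + intros H m. destruct (eventually_all (fun k n => ~ change k x n) m) as [n0 Hn0].
      * intros k _. now apply Hfin.
      * exists (n0 + m)%nat. intros n Hn. apply Hpsi. split; [lia|].
        intros k Hk. apply Hn0; auto. lia.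
    + intros H k. apply NNPP. intros Hno. destruct (H (S k)) as [n0 Hn0].
      destruct (Hinf k x Hno n0) as [n [Hn Hc]]. apply Hn0 in Hn.
      apply Hpsi in Hn as [_ Hn]. exact (Hn k (Nat.lt_succ_diag_r k) Hc).
Qed.

(** * The coding *)

Section Coding.

Context (Y D : cset) (psi : cantor -> nat -> nat) (L n0 : nat) (y1 y0 : cantor).
Context (psi_local : forall x y n, agree x y n -> psi x n = psi y n).
Context (psi_le : forall x n, (psi x n <= n)%nat).
Context (psi_spec : forall x, Y x <->
  forall m, exists n1, forall n, (n1 <= n)%nat -> (m <= psi x n)%nat).
Context (D_det : determined n0 D) (Y_y1 : Y y1) (Y_y0 : ~ Y y0).

(* The non-gap positions are the squares [i * i] with [L <= i]: there a point carries a digit of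
   the point of [Y] or of its complement that it codes. *)
Definition gap (i : nat) : Prop := (i < L * L)%nat \/ forall j, i <> (j * j)%nat.

Definition decode (z : cantor) : cantor := fun n => z ((n + L) * (n + L))%nat.

Definition exit (z : cantor) (p : nat) : Prop :=
  gap p /\ z p = true /\ forall i, (i < p)%nat -> gap i -> z i = false.

Definition core : cset := fun z => forall i, gap i -> z i = false.

(* Truncated subtraction: [lev p = 0] for [p < L * L].  The first [lev p] digits of [decode z] sit
   before the square preceding [p], so the digit at that last square is deliberately ignored. *)
Definition lev (p : nat) : nat := (Nat.sqrt p - L)%nat.

(** The late clause treats three cases at once: if the digits read exclude [Y], the whole exit goes
    out; if they exclude the complement of [Y], none of it; if undecided, the zeros cut off the
    fraction given by the rank. *)
Definition out : cset := fun z => exists p, exit z p /\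
  ((p < L * L)%nat /\ ~ D z \/
   (L * L <= p)%nat /\
   (exists y, agree (decode z) y (lev p) /\ ~ Y y) /\
   ((exists y, agree (decode z) y (lev p) /\ Y y) ->
    zeros z (S p) (psi (decode z) (lev p)))).

Definition inn : cset := fun z => ~ core z /\ ~ out z.

(** * First exits, and openness of [inn] and [out] *)

Lemma exit_before (z : cantor) (i : nat) :
  gap i -> z i = true -> exists p, (p <= i)%nat /\ exit z p.
Proof.
  induction i as [i IH] using (well_founded_induction Nat.lt_wf_0). intros Hg Hz.
  destruct (classic (exists j, (j < i)%nat /\ gap j /\ z j = true)) as [[j [Hj [H1 H2]]]|Hno].
  - destruct (IH j Hj H1 H2) as [p [Hp Hx]]. exists p. split; auto. lia.
  - exists i. split; auto. repeat split; auto. intros j Hj Hgj.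
    destruct (z j) eqn:E; auto. exfalso. apply Hno. exists j. auto.
Qed.

Lemma exit_of_not_core (z : cantor) : ~ core z -> exists p, exit z p.
Proof.
  intros H. apply NNPP. intros Hno. apply H. intros i Hi.
  destruct (z i) eqn:E; auto. destruct (exit_before z i Hi E) as [p [_ Hp]].
  exfalso. apply Hno. now exists p.
Qed.

Lemma exit_not_core (z : cantor) (p : nat) : exit z p -> ~ core z.
Proof. intros [H1 [H2 _]] H. rewrite H in H2; [discriminate | exact H1]. Qed.

Lemma exit_unique (z : cantor) (p q : nat) : exit z p -> exit z q -> p = q.
Proof.
  intros [H1 [H2 H3]] [H4 [H5 H6]].
  destruct (Nat.lt_trichotomy p q) as [H|[H|H]]; auto.
  - rewrite H6 in H2; auto. discriminate.
  - rewrite H3 in H5; auto. discriminate.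
Qed.

Lemma out_not_core (z : cantor) : out z -> ~ core z.
Proof. intros [p [Hp _]]. exact (exit_not_core z p Hp). Qed.

Lemma exit_local (z z' : cantor) (p : nat) : agree z z' (S p) -> exit z p -> exit z' p.
Proof.
  intros Ha [H1 [H2 H3]]. split; [|split]; auto.
  - rewrite <- Ha; auto.
  - intros i Hi Hg. rewrite <- Ha; auto.
Qed.

Lemma gap_between (a i : nat) : (a * a < i < S a * S a)%nat -> gap i.
Proof.
  intros H. right. intros j ->.
  assert (a < j)%nat by nia. assert (j < S a)%nat by nia. lia.
Qed.

Lemma not_gap_square (n : nat) : ~ gap ((n + L) * (n + L)).
Proof. intros [H|H]; [nia | now apply (H (n + L)%nat)]. Qed.

Lemma decode_agree (z z' : cantor) (m k : nat) :
  (forall i, (i < m)%nat -> ((i + L) * (i + L) < k)%nat) ->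
  agree z z' k -> agree (decode z) (decode z') m.
Proof. intros H Ha i Hi. apply Ha. auto. Qed.

Lemma lev_square (p i : nat) : (i < lev p)%nat -> ((i + L) * (i + L) < p)%nat.
Proof.
  unfold lev. intros H. assert (Hi : (S (i + L) <= Nat.sqrt p)%nat) by lia.
  apply Nat.sqrt_le_square in Hi. lia.
Qed.

Lemma lev_le (p : nat) : (lev p <= p)%nat.
Proof. unfold lev. pose proof (Nat.sqrt_le_lin p). lia. Qed.

Lemma lev_early (p : nat) : (p < L * L)%nat -> lev p = O.
Proof.
  unfold lev. intros H. apply Nat.sqrt_lt_square in H. lia.
Qed.

(** Enough digits to decide the side of a point exiting at [p]: those up to [p], at most [p] further
    zeros since [psi] at [lev p] is at most [p], and [n0] digits for [D]. *)
Definition horizon (p : nat) : nat := S (p + p + n0).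

Lemma decode_agree_lev (z z' : cantor) (p k : nat) : (p <= k)%nat ->
  agree z z' k -> agree (decode z) (decode z') (lev p).
Proof.
  intros Hk. apply decode_agree. intros i Hi. apply lev_square in Hi. lia.
Qed.

Lemma out_local (z z' : cantor) (p : nat) :
  exit z p -> agree z z' (horizon p) -> out z -> out z'.
Proof.
  unfold horizon. intros Hp Ha [p' [Hp' H]]. rewrite (exit_unique z p' p Hp' Hp) in H.
  exists p. split; [apply exit_local with z; auto; apply agree_le with (2 := Ha); lia|].
  assert (Hd : agree (decode z') (decode z) (lev p)).
  { apply decode_agree_lev with (2 := agree_sym _ _ _ Ha). lia. }
  destruct H as [[H1 H2]|[H1 [[y [H2 H2']] H3]]].
  - left. split; auto. intros HD. apply H2. apply D_det with z'; auto.
    apply agree_sym, agree_le with (2 := Ha). lia.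
  - right. split; [auto|split].
    + exists y. split; auto. now apply agree_trans with (decode z).
    + intros [w [Hw Hw']] i Hi. rewrite (psi_local _ _ _ Hd) in Hi.
      rewrite <- Ha.
      * apply H3; auto. exists w. split; auto.
        apply agree_trans with (decode z'); auto. now apply agree_sym.
      * pose proof (psi_le (decode z) (lev p)). pose proof (lev_le p). lia.
Qed.

Lemma inn_local (z z' : cantor) (p : nat) :
  exit z p -> agree z z' (horizon p) -> inn z -> inn z'.
Proof.
  intros Hp Ha [_ H].
  assert (Hp' : exit z' p) by (apply exit_local with z; auto; apply agree_le with (2 := Ha); unfold horizon; lia).
  split; [now apply exit_not_core with p|]. intros Ho. apply H.
  apply out_local with z' p; auto. now apply agree_sym.
Qed.

Lemma inn_nbhd (z : cantor) : inn z -> exists n, forall y, agree z y n -> inn y.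
Proof.
  intros H. destruct (exit_of_not_core z (proj1 H)) as [p Hp].
  exists (horizon p). intros y Ha. now apply inn_local with z p.
Qed.

Lemma out_nbhd (z : cantor) : out z -> exists n, forall y, agree z y n -> out y.
Proof.
  intros H. destruct (exit_of_not_core z (out_not_core z H)) as [p Hp].
  exists (horizon p). intros y Ha. now apply out_local with z p.
Qed.

(** * Measure estimates from the growing gaps *)

Lemma core_zeros (z : cantor) (a : nat) : core z -> zeros z (S (a * a)) (2 * a).
Proof. intros H i Hi. apply H, (gap_between a). lia. Qed.

Lemma mu_core : mu core = 0.
Proof.
  apply Rle_antisym; [|apply mu_nonneg]. apply Rnot_lt_le. intros H.
  destruct (half_pow_small _ H) as [n Hn].
  assert (mu core <= (/2) ^ (length (@nil bool) + 2 * n)).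
  { apply (mu_zeros [] (S (n * n))); [simpl; lia|]. intros y Hy. split; [apply N_nil|].
    now apply core_zeros. }
  pose proof (half_pow_le n (length (@nil bool) + 2 * n)) as Hle.
  specialize (Hle ltac:(simpl; lia)). lra.
Qed.

Lemma inn_measurable : measurable inn.
Proof.
  apply measurable_of_approx. intros e He. destruct (half_pow_small e He) as [a Ha].
  set (m := horizon (S a * S a)).
  (* A point with a 1 in the gap after [a * a] has exited before the next square, so [m] digits
     decide it. An error thus needs [2 * a] zeros. *)
  exists m, (fun z => forall y, agree z y m -> inn y). split.
  - intros x y Hxy H w Hw. apply H. now apply agree_trans with y.
  - apply Rle_lt_trans with ((/2) ^ (length (@nil bool) + 2 * a)).
    + apply (mu_zeros [] (S (a * a))); [simpl; lia|]. intros z [[Hz Hno]|[Hz Hno]].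
      * split; [apply N_nil|]. intros i Hi. destruct (z i) eqn:E; auto.
        exfalso. apply Hno. destruct (exit_before z i) as [p [Hp Hx]]; auto.
        { apply (gap_between a). lia. }
        intros y Hy. apply inn_local with z p; auto. apply agree_le with (2 := Hy).
        unfold m, horizon. lia.
      * exfalso. apply Hno, Hz. intros i _. reflexivity.
    + apply Rle_lt_trans with (2 := Ha). apply half_pow_le. simpl. lia.
Qed.

(** All positions below [L * L] are gaps, so a 1 there forces an early exit, which [D] sorts
    correctly. *)
Lemma mu_symdiff_inn : mu (symdiff D inn) <= (/2) ^ (L * L).
Proof.
  apply (mu_zeros [] 0 (L * L)); [apply Nat.le_refl|]. intros z Hz. split; [apply N_nil|].
  intros i Hi. destruct (z i) eqn:E; auto. exfalso.
  destruct (exit_before z i) as [p [Hp Hx]]; auto; [left; lia|].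
  assert (Hout : out z <-> ~ D z).
  { split.
    - intros [q [Hq H]]. rewrite (exit_unique z q p Hq Hx) in H.
      destruct H as [[_ H]|[H _]]; [exact H | lia].
    - intros H. exists p. split; auto. left. split; auto. lia. }
  pose proof (exit_not_core z p Hx). unfold symdiff, inn in Hz. tauto.
Qed.

(* Halving: at a gap, one half of the cylinder exits at once and then must see [M] zeros. *)
Lemma mu_exits (M j : nat) (s : list bool) (A : cset) :
  (forall y, A y -> N s y /\ exists p, (length s <= p < length s + j)%nat /\ gap p /\
     y p = true /\ (forall i, (length s <= i < p)%nat -> gap i -> y i = false) /\
     zeros y (S p) M) ->
  mu A <= (/2) ^ (length s + M).
Proof.
  revert s A. induction j as [|j IH]; intros s A H.
  - rewrite mu_empty; [left; apply half_pow_pos|]. intros y Hy.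
    destruct (H y Hy) as [_ [p [Hp _]]]. lia.
  - assert (HA : mu A = mu (inter A (N s))).
    { apply mu_ext. intros x. unfold inter. split; [|tauto]. intros Hx. split; auto. now apply H. }
    rewrite HA, mu_split.
    assert (Hb : forall b, mu (inter A (N (s ++ [b]))) <= (/2) ^ (S (length s + M))).
    { intros b. replace (S (length s + M)) with (length (s ++ [b]) + M)%nat
        by (rewrite length_app; simpl; lia).
      assert (Hl : length (s ++ [b]) = S (length s)) by (rewrite length_app; simpl; lia).
      destruct (classic (gap (length s) /\ b = true)) as [[Hg ->]|Hno].
      - rewrite <- mu_zeros_at. apply mu_mono. intros y [Hy Hs]. split; auto.
        destruct (H y Hy) as [_ [p [Hp [H1 [H2 [H3 H4]]]]]].
        apply N_snoc in Hs as [_ Hs]. rewrite Hl.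
        destruct (Nat.eq_dec p (length s)) as [->|]; auto.
        rewrite H3 in Hs; [discriminate | lia | exact Hg].
      - apply IH. intros y [Hy Hs]. split; auto.
        destruct (H y Hy) as [_ [p [Hp [H1 [H2 [H3 H4]]]]]]. rewrite Hl.
        exists p. repeat split; auto; try lia.
        + assert (p <> length s); [|lia]. intros ->. apply Hno. split; auto.
          apply N_snoc in Hs as [_ Hs]. congruence.
        + intros i Hi. apply H3. lia. }
    pose proof (Hb true). pose proof (Hb false). simpl in *. lra.
Qed.

(** * Density of [inn] at points of the core *)

Lemma Phi_core_of_Y (z : cantor) : core z -> Y (decode z) -> Phi inn z.
Proof.
  intros Hz HY. apply Phi_intro. intros M.
  destruct (proj1 (psi_spec _) HY M) as [q0 Hq0].
  (* The first summand gives every exit from [k] on a level of at least [q0], hence rank at least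
     [M]; the second gives [M <= a]. *)
  exists (S ((L + q0) * (L + q0) + M * M)). intros k Hk.
  set (a := Nat.sqrt_up k).
  assert (Ha : (Nat.pred a * Nat.pred a < k <= a * a)%nat) by (apply Nat.sqrt_up_spec; lia).
  set (s := restr z k). assert (Hs : length s = k) by apply restr_length.
  (* [a * a] is the first square not fixed by [s]. A point outside [inn] either exits by the end of
     the gap after it, and then shows [M] zeros, or has [2 * a] zeros in that gap. *)
  assert (Hsplit : mu (diff (N s) inn) <= (/2) ^ (length s + M) + (/2) ^ (length s + 2 * a)).
  { apply Rle_trans with
      (mu (fun y => N s y /\ exists p, (length s <= p < length s + S a * S a)%nat /\ gap p /\
         y p = true /\ (forall i, (length s <= i < p)%nat -> gap i -> y i = false) /\
         zeros y (S p) M) +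
       mu (fun y => N s y /\ zeros y (S (a * a)) (2 * a))).
    2: { apply Rplus_le_compat; [now apply mu_exits with (S a * S a)%nat|].
         apply mu_zeros with (S (a * a)); [lia|]. auto. }
    apply mu_le_add. intros y [Hy Hin].
    destruct (classic (zeros y (S (a * a)) (2 * a))) as [|Hnz]; [now right|]. left.
    split; auto. pose proof (proj1 (N_restr _ _ _) Hy) as Hag.
    assert (Hi : exists i, (S (a * a) <= i < S (a * a) + 2 * a)%nat /\ y i = true).
    { apply NNPP. intros H. apply Hnz. intros i Hi. destruct (y i) eqn:E; auto.
      exfalso. apply H. now exists i. }
    destruct Hi as [i [Hi Hyi]].
    destruct (exit_before y i) as [p [Hp Hx]]; auto; [apply (gap_between a); lia|].
    pose proof Hx as [Hgp [Hyp Hfirst]].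
    assert (Hkp : (k <= p)%nat).
    { destruct (Nat.le_gt_cases k p) as [|Hlt]; auto.
      rewrite <- Hag, Hz in Hyp; auto. discriminate. }
    exists p. rewrite Hs. repeat split; auto; [lia|intros; apply Hfirst; auto; lia|].
    assert (Hout : out y) by (apply NNPP; intros Ho; apply Hin; split; auto; now apply exit_not_core with p).
    destruct Hout as [p' [Hx' Ho]]. rewrite (exit_unique y p' p Hx' Hx) in Ho.
    assert (Hlow : (L + q0 <= Nat.sqrt p)%nat) by (apply Nat.sqrt_le_square; lia).
    assert (Hup : (Nat.sqrt p < S a)%nat) by (apply Nat.sqrt_lt_square; lia).
    destruct Ho as [[Ho _]|[_ [_ Ho]]]; [apply Nat.sqrt_lt_square in Ho; lia|].
    (* Here the lag of [lev] matters: the level reads squares only up to that of [Nat.pred a], all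
       below [k], so [y] and [z] have the same rank although they may differ at [a * a]. *)
    assert (Hd : agree (decode y) (decode z) (lev p)).
    { apply decode_agree with k; [|now apply agree_sym]. unfold lev. intros j Hj.
      assert (Hja : (j + L <= Nat.pred a)%nat) by lia. apply Nat.square_le_mono in Hja. lia. }
    rewrite (psi_local _ _ _ Hd) in Ho. intros j Hj. apply Ho.
    - exists (decode z). auto.
    - assert (q0 <= lev p)%nat by (unfold lev; lia).
      specialize (Hq0 (lev p)). lia. }
  eapply Rle_trans; [exact Hsplit|]. rewrite Hs, !pow_add.
  assert (M <= a)%nat by (apply Nat.square_le_mono; lia).
  assert (HMa : (/2) ^ (2 * a) <= (/2) ^ M) by (apply half_pow_le; lia).
  pose proof (Rmult_le_compat_l _ _ _ (Rlt_le _ _ (half_pow_pos k)) HMa). lra.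
Qed.

Lemma Phi_core_Y (z : cantor) : core z -> Phi inn z -> Y (decode z).
Proof.
  intros Hz HP. apply NNPP. intros HY.
  assert (Hm : exists m, forall n1, exists n, (n1 <= n)%nat /\ (psi (decode z) n < m)%nat).
  { apply NNPP. intros Hno. apply HY, psi_spec. intros m. apply NNPP. intros Hm.
    apply Hno. exists m. intros n1. apply NNPP. intros Hn. apply Hm. exists n1.
    intros n Hn'. destruct (Nat.le_gt_cases m (psi (decode z) n)); auto.
    exfalso. apply Hn. now exists n. }
  destruct Hm as [m Hm].
  (* Whenever the rank is below [m], exiting at once costs one half and the zeros at most [m]
     further halvings, so a fraction of at least [(/2) ^ S m] is out. *)
  destruct (Phi_elim inn z ((/2) ^ S m) HP (half_pow_pos _)) as [k0 Hk0].
  destruct (Hm (S k0)) as [q [Hq Hpsi]].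
  (* The first gap position at which the level equals [q]. *)
  set (k := S ((q + L) * (q + L))).
  assert (Hgap : gap k) by (apply (gap_between (q + L)); unfold k; lia).
  assert (Hlev : lev k = q).
  { unfold lev. rewrite (Nat.sqrt_unique k (q + L)); unfold k; lia. }
  assert (HLk : (L * L <= (q + L) * (q + L))%nat) by (apply Nat.square_le_mono; lia).
  assert (Hqk : (q <= (q + L) * (q + L))%nat) by nia.
  specialize (Hk0 k ltac:(unfold k; lia)).
  set (s := restr z k) in *. assert (Hs : length s = k) by apply restr_length.
  assert (Hl : length (s ++ [true]) = S k) by (rewrite length_app, Hs; apply Nat.add_1_r).
  set (T := fun y => N (s ++ [true]) y /\
              zeros y (length (s ++ [true])) (psi (decode z) q)).
  assert (HT : mu T = (/2) ^ (S k + psi (decode z) q)) by (unfold T; rewrite mu_zeros_at, Hl; reflexivity).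
  assert (HTm : measurable T).
  { apply determined_measurable with (S k + psi (decode z) q)%nat.
    intros x y Ha [H1 H2]. split.
    - apply N_agree with x; auto. apply agree_le with (2 := Ha). lia.
    - intros i Hi. rewrite <- Ha; [auto | lia]. }
  assert (HTout : forall y, T y -> out y).
  { intros y [H1 H2]. rewrite Hl in H2. apply N_snoc in H1 as [H1 H1'].
    rewrite Hs in H1'. apply N_restr in H1. exists k. split; [split; [|split]; auto|].
    - intros i Hi Hg. rewrite <- H1; auto.
    - right. split; [unfold k; lia|].
      assert (Hd : agree (decode y) (decode z) (lev k)).
      { apply decode_agree_lev with k; auto. now apply agree_sym. }
      split.
      + exists (decode z). auto.
      + intros _. rewrite (psi_local _ _ _ Hd), Hlev. exact H2. }
  pose proof (HTm (N s)) as Hsplit. rewrite mu_N, Hs in Hsplit.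
  rewrite (mu_ext (inter (N s) T) T) in Hsplit
    by (unfold inter, T; intros x; rewrite N_snoc; tauto).
  assert (mu (inter inn (N s)) <= mu (diff (N s) T)).
  { apply mu_mono. intros x [[_ Hx] Hx']. split; auto. }
  rewrite HT in Hsplit.
  assert (Hpow : (/2) ^ (S k + m) <= (/2) ^ (S k + psi (decode z) q)) by (apply half_pow_le; lia).
  rewrite pow_add in Hpow. simpl in *. lra.
Qed.

Lemma Phi_inn (z : cantor) : Phi inn z <-> inn z \/ core z /\ Y (decode z).
Proof.
  split.
  - intros HP. destruct (classic (core z)) as [Hz|Hz].
    + right. split; auto. now apply Phi_core_Y.
    + left. split; auto. intros Ho. destruct (out_nbhd z Ho) as [n Hn].
      apply (Phi_of_disjoint_nbhd inn z n); auto. intros y Hy [_ H]. auto.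
  - intros [H|[H1 H2]].
    + destruct (inn_nbhd z H) as [n Hn]. now apply Phi_of_nbhd with n.
    + now apply Phi_core_of_Y.
Qed.

(** * The Wadge reductions in both directions *)

Definition encode (x : cantor) : cantor := fun i =>
  if excluded_middle_informative (gap i) then false else x (Nat.sqrt i - L)%nat.

Lemma encode_core (x : cantor) : core (encode x).
Proof. intros i Hi. unfold encode. now destruct (excluded_middle_informative _). Qed.

Lemma decode_encode (x : cantor) : decode (encode x) = x.
Proof.
  apply functional_extensionality. intros n. unfold decode, encode.
  destruct (excluded_middle_informative _) as [H|_]; [now apply not_gap_square in H|].
  rewrite Nat.sqrt_square. f_equal. lia.
Qed.

Lemma wadge_le_Phi_inn : wadge_le Y (Phi inn).
Proof.
  exists encode. split.
  - intros x n. exists n. intros y Ha i Hi. unfold encode.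
    destruct (excluded_middle_informative _); auto. apply Ha.
    pose proof (Nat.sqrt_le_lin i). lia.
  - intros x. rewrite Phi_inn, decode_encode. pose proof (encode_core x) as H.
    unfold inn. tauto.
Qed.

Definition nearby (P : cset) (x : cantor) (q : nat) : cantor :=
  epsilon (inhabits (fun _ => false)) (fun y => agree x y q /\ P y).

(** The choice depends only on the predicate, so extensionality makes it a function of the first [q]
    digits; hence [retract] is locally constant off the core. *)
Lemma nearby_local (P : cset) (x x' : cantor) (q : nat) :
  agree x x' q -> nearby P x q = nearby P x' q.
Proof.
  intros H. unfold nearby. f_equal. apply functional_extensionality. intros y.
  apply propositional_extensionality. split; intros [H1 H2]; split; auto.
  - now apply agree_trans with x; [apply agree_sym|].
  - now apply agree_trans with x'.
Qed.

Lemma nearby_spec (P : cset) (x : cantor) (q : nat) : (exists y, agree x y q /\ P y) ->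
  agree x (nearby P x q) q /\ P (nearby P x q).
Proof. exact (epsilon_spec _ (fun y => agree x y q /\ P y)). Qed.

Definition first_exit (z : cantor) : nat := epsilon (inhabits O) (exit z).

Lemma first_exit_eq (z : cantor) (p : nat) : exit z p -> first_exit z = p.
Proof.
  intros H. apply (exit_unique z); auto. unfold first_exit. apply epsilon_spec. now exists p.
Qed.

Definition side (z : cantor) : cset := fun y => inn z <-> Y y.

Definition retract (z : cantor) : cantor :=
  if excluded_middle_informative (core z) then decode z
  else nearby (side z) (decode z) (lev (first_exit z)).

Lemma retract_exit (z : cantor) (p : nat) : exit z p ->
  retract z = nearby (side z) (decode z) (lev p).
Proof.
  intros Hp. unfold retract. rewrite (first_exit_eq z p Hp).
  destruct (excluded_middle_informative _) as [H|]; auto. now apply exit_not_core in Hp.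
Qed.

(** At an early exit the level is 0, so [y1] or [y0] serves. At a late one, [out] supplies a
    nonmember itself, and were no member of [Y] compatible with the digits read, [decode z] would
    put [z] in [out]. *)
Lemma side_exists (z : cantor) (p : nat) : exit z p ->
  exists y, agree (decode z) y (lev p) /\ side z y.
Proof.
  intros Hp. unfold side. pose proof (exit_not_core z p Hp) as Hc.
  destruct (classic (out z)) as [Ho|Ho].
  - assert (Hn : ~ inn z) by (unfold inn; tauto).
    destruct Ho as [p' [Hp' H]]. rewrite (exit_unique z p' p Hp' Hp) in H.
    destruct H as [[H _]|[_ [[y [H1 H2]] _]]].
    + exists y0. rewrite lev_early by exact H. split; [intros i Hi; lia | tauto].
    + exists y. tauto.
  - assert (Hi : inn z) by (unfold inn; tauto).
    destruct (Nat.lt_ge_cases p (L * L)) as [H|H].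
    + exists y1. rewrite lev_early by exact H. split; [intros i Hi'; lia | tauto].
    + apply NNPP. intros Hno.
      assert (Hno' : forall y, agree (decode z) y (lev p) -> ~ Y y).
      { intros y Hy HY. apply Hno. exists y. tauto. }
      apply Ho. exists p. split; auto. right. split; [auto|split].
      * exists (decode z). split; [intros i _; reflexivity|].
        apply Hno'. intros i _. reflexivity.
      * intros [y [H1 H2]]. exfalso. now apply (Hno' y).
Qed.

Lemma retract_continuous : continuous retract.
Proof.
  intros z n. destruct (classic (core z)) as [Hz|Hz].
  - assert (Hr : retract z = decode z).
    { unfold retract. now destruct (excluded_middle_informative _). }
    (* A point agreeing with [z] this far can exit only at or after that square, where the level is
       at least [n]. *)
    rewrite Hr. exists ((n + L) * (n + L))%nat. intros y Ha.
    assert (Hd : agree (decode z) (decode y) n).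
    { apply decode_agree with (2 := Ha). intros i Hi.
      apply (proj1 (Nat.square_lt_mono _ _)). lia. }
    destruct (classic (core y)) as [Hy|Hy].
    + unfold retract. now destruct (excluded_middle_informative _).
    + destruct (exit_of_not_core y Hy) as [p Hp]. rewrite (retract_exit y p Hp).
      apply agree_trans with (decode y); auto.
      apply agree_le with (lev p); [|now apply nearby_spec, side_exists].
      assert (Hle : ((n + L) * (n + L) <= p)%nat).
      { destruct (Nat.le_gt_cases ((n + L) * (n + L)) p) as [|Hlt]; auto.
        destruct Hp as [Hg [Hp _]]. rewrite <- Ha, Hz in Hp; auto. discriminate. }
      apply Nat.sqrt_le_square in Hle. unfold lev. lia.
  - destruct (exit_of_not_core z Hz) as [p Hp]. exists (horizon p). intros y Ha.
    assert (Hp' : exit y p).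
    { apply exit_local with z; auto. apply agree_le with (2 := Ha). unfold horizon. lia. }
    rewrite (retract_exit z p Hp), (retract_exit y p Hp').
    assert (Hside : side z = side y).
    { assert (Hin : inn z <-> inn y).
      { split; apply inn_local with p; auto. now apply agree_sym. }
      apply functional_extensionality. intros w. apply propositional_extensionality.
      unfold side. now rewrite Hin. }
    rewrite Hside, (nearby_local _ (decode z) (decode y)).
    + intros i _. reflexivity.
    + apply decode_agree_lev with (2 := Ha). unfold horizon. lia.
Qed.

Lemma Phi_inn_wadge_le : wadge_le (Phi inn) Y.
Proof.
  exists retract. split; [exact retract_continuous|]. intros z. rewrite Phi_inn.
  destruct (classic (core z)) as [Hz|Hz].
  - unfold retract. destruct (excluded_middle_informative _); [|tauto]. unfold inn. tauto.
  - destruct (exit_of_not_core z Hz) as [p Hp]. rewrite (retract_exit z p Hp).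
    destruct (nearby_spec (side z) (decode z) (lev p)) as [_ H]; [now apply side_exists|].
    unfold side in H. tauto.
Qed.

End Coding.

Theorem theorem1p8 :
  forall d : cset -> Prop,
    wadge_degree d ->
    (forall X, d X -> Pi03 X) ->
    ~ (forall X, d X <-> (forall x, ~ X x)) ->
    ~ (forall X, d X <-> (forall x, X x)) ->
    forall A : cset, measurable A ->
    forall eps : R, 0 < eps ->
    exists B : cset,
      measurable B /\ mu (symdiff A B) < eps /\ d (Phi B) /\
      exists U C : cset, open U /\ closed C /\
        (forall x, Phi B x <-> Phi U x) /\ (forall x, Phi B x <-> Phi C x).
Proof.
  intros d [Y HY] HPi Hne Hnf A HA eps Heps.
  assert (Hid : continuous (fun x => x)) by (intros x n; exists n; auto).
  (* A constant [Y] has only itself in its degree; with [P] false or true this is one of the two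
     excluded degrees. *)
  assert (Hdeg : forall P : Prop, (forall x, Y x <-> P) ->
            forall X, d X <-> (forall x, X x <-> P)).
  { intros P HP X. rewrite HY. split.
    - intros [[f [_ Hf]] _] x. now rewrite Hf.
    - intros HX. split; exists (fun x => x); split; auto; intros x; now rewrite HX, HP. }
  assert (Hy1 : exists y1, Y y1).
  { apply NNPP. intros H. apply Hne. intros X. rewrite (Hdeg False) by firstorder. firstorder. }
  assert (Hy0 : exists y0, ~ Y y0).
  { apply NNPP. intros H. apply Hnf. intros X. rewrite (Hdeg True); [firstorder|].
    intros x. split; auto. intros _. apply NNPP. firstorder. }
  destruct Hy1 as [y1 Hy1]. destruct Hy0 as [y0 Hy0].
  assert (HYd : Pi03 Y).
  { apply HPi, HY. split; exists (fun x => x); split; auto; reflexivity. }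
  destruct (Pi03_rank Y HYd) as [psi [Hloc [Hle Hspec]]].
  destruct (measurable_approx A (eps / 2) HA) as [n0 [D [HD HAD]]]; [lra|].
  destruct (half_pow_small (eps / 2)) as [L HL]; [lra|].
  set (U := inn Y D psi L).
  exists U. split; [|split; [|split]].
  - now apply inn_measurable with n0.
  - assert (mu (symdiff A U) <= mu (symdiff A D) + mu (symdiff D U)).
    { apply mu_le_add. intros x. unfold symdiff. tauto. }
    assert (mu (symdiff D U) <= (/2) ^ (L * L)) by apply mu_symdiff_inn.
    assert ((/2) ^ (L * L) <= (/2) ^ L) by (apply half_pow_le; nia).
    lra.
  - apply HY. split.
    + now apply Phi_inn_wadge_le with n0 y1 y0.
    + now apply wadge_le_Phi_inn with n0.
  - exists U, (compl (out Y D psi L)). split; [|split; [|split]].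
    + intros x. now apply inn_nbhd with n0.
    + intros x Hx. apply NNPP in Hx. destruct (out_nbhd Y D psi L n0 Hloc Hle HD x Hx) as [n Hn].
      exists n. intros y Hy Hc. apply Hc. auto.
    + reflexivity.
    + intros x. symmetry. apply Phi_null.
      * intros y [_ H]. exact H.
      * apply Rle_antisym; [|apply mu_nonneg]. rewrite <- (mu_core L). apply mu_mono.
        intros y [H1 H2]. apply NNPP. intros H. apply H2. now split.
Qed.
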